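(* Let ${\sf Perfect}_{\sf bin}$ be the following formula about a binary tree $T\subseteq2^{<\omega}$: $$\forall\sigma\in T\ \big[{\sf Ext}(\sigma,T)\to\exists\tau_0,\tau_1\in T\ (\tau_0,\tau_1\text{ extend }\sigma\ \wedge\ \tau_0\bot\tau_1\ \wedge\ \forall i<2.\ {\sf Ext}(\tau_i,T))\big],$$ where ${\sf Ext}(\sigma,T)\equiv\forall\ell\,\exists\tau\in2^\ell.\ \sigma^\frown\tau\in T$ and $\tau_0\bot\tau_1$ means that $\tau_0,\tau_1$ are incomparable. Then ${\sf Perfect}_{\sf bin}$ is $\forall^\to\exists\forall$-dicomplete.
   Context: Number quantifiers range over $\omega$. Instances are tuples of natural numbers and/or total computable functions (computable elements of $\omega^\omega$); spaces such as $\omega\times\omega^\omega$, $(\omega^\omega)^\omega$ are identified with $\omega^\omega$ by computable pairing. A tree $T\subseteq2^{<\omega}$ is a set of (coded) finite binary strings closed under initial segments, given by its characteristic function; instances of ${\sf Perfect}_{\sf bin}$ are (computable) codes of such trees. In ${\sf Ext}$ the quantifier over $\tau\in2^\ell$ is bounded, so ${\sf Ext}$ is a $\forall$-formula. A $\forall^\to\exists\forall$-formula is a formula of the form $\forall a[\forall b\,\gamma(a,b,x)\to\exists c\,\forall d\,\theta(a,c,d,x)]$ with $\gamma,\theta$ bounded formulas. Its dual, a $\exists^\wedge\forall\exists$-formula, is $\exists a[\forall b\,\gamma(a,b,x)\wedge\forall c\,\exists d\,\neg\theta(a,c,d,x)]$. ${\sf Perfect}_{\sf bin}$ is put in this form with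 $a=\sigma$, $c=(\tau_0,\tau_1)$ (conditions of membership in $T$ being decidable). Witnesses (in simplified form, omitting computably recoverable information): a witness for $\forall a[\forall b\,\gamma\to\exists c\,\forall d\,\theta]$ at $x$ is a partial function $f:\omega\rightharpoonup\omega$, presented by an element of $\omega^\omega$ enumerating its graph, such that for every $a$ with $\forall b\,\gamma(a,b,x)$, $f(a)$ is defined and $\forall d\,\theta(a,f(a),d,x)$. A witness for the dual at $x$ is a number $a$ with $\forall b\,\gamma(a,b,x)\wedge\forall c\,\exists d\,\neg\theta(a,c,d,x)$. Reducibility: $\varphi\le_{\sf m}\psi$ if there are computable functions $\eta,r_-,r_+$ (type-two computable functionals, possibly partial but defined wherever required) such that for every instance $x$ of $\varphi$, $\eta(x)$ is an instance of $\psi$; $\varphi(x)$ is true iff $\psi(\eta(x))$ is true; if $\alpha$ is a witness for $\varphi(x)$ then $r_-(\alpha,x)$ is a witness for $\psi(\eta(x))$; if $\alpha$ is a witness for $\psi(\eta(x))$ then $r_+(\alpha,x)$ is a witness for $\varphi(x)$. $\varphi\le_{\sf dm}\psi$ if $\varphi\le_{\sf m}\psi$ and $\varphi^{\sf d}\le_{\sf m}\psi^{\sf d}$ via a common $\eta$ (the $r_\pm$ may differ), where $^{\sf d}$ denotes the dual. A formula is strictly $\forall^\to\exists\forall$-dicomplete if it is a $\forall^\to\exists\forall$-formula and every $\forall^\to\exists\forall$-formula is $\le_{\sf dm}$-reducible to it; it is $\forall^\to\exists\forall$-dicomplete if it is $\equiv_{\sf dm}$-equivalent to a strictly $\forall^\to\exists\forall$-dicomplete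 formula. *)

(* Defs.v *)
From mathcomp Require Import all_boot.

Set Implicit Arguments.
Unset Strict Implicit.
Unset Printing Implicit Defensive.

Definition baire := nat -> nat.

(* Partial recursive functions with oracles.  Arities are not tracked: missing
   arguments and missing oracles read as 0 (but [CPrec] needs its recursion
   argument). *)
Inductive code : Type :=
| CZero
| CSucc
| CProj of nat
| COracle of nat
| CComp of code & seq code
| CPrec of code & code
| CMu of code.

(* [eval o c v r]: with oracles [o], the program [c] halts on the arguments [v]
   with the value [r]. *)
Inductive eval (o : seq baire) : code -> seq nat -> nat -> Prop :=
| EvZero v : eval o CZero v 0
| EvSucc v : eval o CSucc v (head 0 v).+1
| EvProj i v : eval o (CProj i) v (nth 0 v i)
| EvOracle i v :
    eval o (COracle i) v (nth (fun=> 0) o i (head 0 v))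
| EvComp f gs v ws r :
    evals o gs v ws -> eval o f ws r -> eval o (CComp f gs) v r
| EvPrec0 f g v r :
    eval o f v r -> eval o (CPrec f g) (0 :: v) r
| EvPrecS f g n v r s :
    eval o (CPrec f g) (n :: v) r -> eval o g [:: n, r & v] s ->
    eval o (CPrec f g) (n.+1 :: v) s
| EvMu f v n (r : nat -> nat) :
    eval o f (n :: v) 0 ->
    (forall m, m < n -> eval o f (m :: v) (r m).+1) ->
    eval o (CMu f) v n
with evals (o : seq baire) : seq code -> seq nat -> seq nat -> Prop :=
| EvNil v : evals o [::] v [::]
| EvCons g gs v w ws :
    eval o g v w -> evals o gs v ws -> evals o (g :: gs) v (w :: ws).

(* The type-two functional with program [c] is defined at [o], with value [y]. *)
Definition computes (c : code) (o : seq baire) (y : baire) : Prop :=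
  forall n, eval o c [:: n] (y n).

Definition computable (x : baire) : Prop := exists c, computes c [::] x.

(* Cantor pairing. *)
Definition cpair (a b : nat) : nat := ((a + b) * (a + b).+1)./2 + b.

(* The tuple of parameters of a formula is presented as a single function [x];
   [TApp t] is the term x(t).  Exponentiation is in the language so that
   quantifiers over 2^l are bounded.  Number variables are de Bruijn indices. *)
Inductive term : Type :=
| TVar of nat
| TZero
| TSucc of term
| TAdd of term & term
| TMul of term & term
| TExp of term & term
| TApp of term.

Inductive bformula : Type :=
| BEq of term & term
| BLt of term & term
| BNot of bformula
| BAnd of bformula & bformula
| BOr of bformula & bformula
| BAll of term & bformula
| BEx of term & bformula.

Fixpoint tval (x : baire) (v : seq nat) (t : term) : nat :=
  match t with
  | TVar i => nth 0 v i
  | TZero => 0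
  | TSucc t => (tval x v t).+1
  | TAdd t u => tval x v t + tval x v u
  | TMul t u => tval x v t * tval x v u
  | TExp t u => tval x v t ^ tval x v u
  | TApp t => x (tval x v t)
  end.

(* The bound of a quantifier is evaluated outside of its scope, and is strict. *)
Fixpoint bsat (x : baire) (v : seq nat) (F : bformula) : bool :=
  match F with
  | BEq t u => tval x v t == tval x v u
  | BLt t u => tval x v t < tval x v u
  | BNot F => ~~ bsat x v F
  | BAnd F G => bsat x v F && bsat x v G
  | BOr F G => bsat x v F || bsat x v G
  | BAll t F => [forall k : 'I_(tval x v t), bsat x (val k :: v) F]
  | BEx t F => [exists k : 'I_(tval x v t), bsat x (val k :: v) F]
  end.

(* A formula "forall a, (forall b, gamma) -> exists c, forall d, theta" about
   the parameters [x] in [dom]. *)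
Record aeform : Type := AEForm {
  dom : baire -> Prop;
  gamma : nat -> nat -> baire -> Prop;
  theta : nat -> nat -> nat -> baire -> Prop }.

Definition is_AE_formula (phi : aeform) : Prop :=
  exists G H : bformula,
    (forall a b x, gamma phi a b x <-> bsat x [:: a; b] G) /\
    (forall a c d x, theta phi a c d x <-> bsat x [:: a; c; d] H).

Definition is_instance (phi : aeform) (x : baire) : Prop :=
  computable x /\ dom phi x.

Definition holds (phi : aeform) (x : baire) : Prop :=
  forall a, (forall b, gamma phi a b x) ->
  exists c, forall d, theta phi a c d x.

Definition dual_holds (phi : aeform) (x : baire) : Prop :=
  exists a, (forall b, gamma phi a b x) /\
            (forall c, exists d, ~ theta phi a c d x).

(* [alpha] enumerates a set of pairs; the value 0 enumerates nothing, so that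
   every partial function with an empty graph has an enumeration too. *)
Definition graph (alpha : baire) (a c : nat) : Prop :=
  exists n, alpha n = (cpair a c).+1.

Definition witness (phi : aeform) (x alpha : baire) : Prop :=
  (forall a c c', graph alpha a c -> graph alpha a c' -> c = c') /\
  (forall a, (forall b, gamma phi a b x) ->
     exists c, graph alpha a c /\ forall d, theta phi a c d x).

(* The number [a] is presented by the constant sequence with value [a]. *)
Definition dual_witness (phi : aeform) (x alpha : baire) : Prop :=
  exists a, [/\ forall n, alpha n = a,
                forall b, gamma phi a b x
              & forall c, exists d, ~ theta phi a c d x].

Record problem : Type := Problem {
  pinst : baire -> Prop;
  ptrue : baire -> Prop;
  pwit : baire -> baire -> Prop }.

Definition primal (phi : aeform) : problem :=
  Problem (is_instance phi) (holds phi) (witness phi).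

Definition dual (phi : aeform) : problem :=
  Problem (is_instance phi) (dual_holds phi) (dual_witness phi).

Definition m_reduces_via (eta : code) (P Q : problem) : Prop :=
  exists rminus rplus : code, forall x, pinst P x ->
  exists y, [/\ computes eta [:: x] y,
    pinst Q y,
    ptrue P x <-> ptrue Q y,
    forall alpha, pwit P x alpha ->
      exists beta, computes rminus [:: alpha; x] beta /\ pwit Q y beta
  & forall alpha, pwit Q y alpha ->
      exists beta, computes rplus [:: alpha; x] beta /\ pwit P x beta].

Definition le_dm (phi psi : aeform) : Prop :=
  exists eta, m_reduces_via eta (primal phi) (primal psi) /\
              m_reduces_via eta (dual phi) (dual psi).

Definition equiv_dm (phi psi : aeform) : Prop :=
  le_dm phi psi /\ le_dm psi phi.

Definition strictly_dicomplete (psi : aeform) : Prop :=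
  is_AE_formula psi /\ forall phi, is_AE_formula phi -> le_dm phi psi.

Definition dicomplete (phi : aeform) : Prop :=
  exists psi, strictly_dicomplete psi /\ equiv_dm phi psi.

(* Bijective base 2, least significant digit first; a bijection onto [nat]. *)
Fixpoint strcode (s : seq bool) : nat :=
  if s is b :: s' then (strcode s').*2 + b.+1 else 0.

Definition in_tree (T : baire) (s : seq bool) : Prop := T (strcode s) = 1.

Definition is_tree (T : baire) : Prop :=
  (forall n, T n <= 1) /\
  (forall s t : seq bool, prefix s t -> in_tree T t -> in_tree T s).

Definition Ext (s : seq bool) (T : baire) : Prop :=
  forall l, exists t : l.-tuple bool, in_tree T (s ++ t).

Definition incomparable (s t : seq bool) : bool :=
  ~~ prefix s t && ~~ prefix t s.

Definition perfect_bin_statement (T : baire) : Prop :=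
  forall s, in_tree T s -> Ext s T ->
  exists t : bool -> seq bool,
    [/\ forall i, in_tree T (t i), forall i, prefix s (t i),
        incomparable (t false) (t true) & forall i, Ext (t i) T].

(* The same formula in normal form, see [holds_Perfect_bin] below. *)
Definition Perfect_bin : aeform := AEForm
  is_tree
  (fun a b T => exists s : seq bool,
     [/\ a = strcode s, in_tree T s
       & exists t : b.-tuple bool, in_tree T (s ++ t)])
  (fun a c d T => exists (s : seq bool) (t : bool -> seq bool),
     [/\ a = strcode s, c = cpair (strcode (t false)) (strcode (t true)),
         forall i, in_tree T (t i) /\ prefix s (t i),
         incomparable (t false) (t true)
       & forall i, exists u : d.-tuple bool, in_tree T (t i ++ u)]).

Lemma strcode_inj : injective strcode.
Proof.
elim=> [|b s IH] [|c t] //=; [by rewrite addnS | by rewrite addnS |].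
rewrite !addnS => -[E].
have bc : b = c.
  by move: (congr1 odd E); rewrite !oddD !odd_double; case: b {E}; case: c.
by rewrite -bc; congr (_ :: _); apply: IH; move: E; rewrite bc => /addIn/double_inj.
Qed.

Lemma cpair_inj a b c d : cpair a b = cpair c d -> a = c /\ b = d.
Proof.
have tri n : (n * n.+1)./2 + n.+1 = (n.+1 * n.+2)./2.
  have -> : n.+1 * n.+2 = n * n.+1 + n.+1.*2.
    by rewrite -muln2 (mulnC n) -mulnDr addn2.
  by rewrite halfD odd_double andbF add0n doubleK.
have mono m n : m < n -> (m * m.+1)./2 + m < (n * n.+1)./2.
  move=> mn; rewrite -addnS tri; apply: half_leq.
  by apply: leq_mul.
have aux m b' n d' : b' <= m -> m < n -> (m * m.+1)./2 + b' < (n * n.+1)./2 + d'.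
  move=> bm mn; apply: leq_ltn_trans (_ : (m * m.+1)./2 + m < _).
    by rewrite leq_add2l.
  by apply: leq_trans (mono _ _ mn) (leq_addr _ _).
rewrite /cpair => E; case: (ltngtP (a + b) (c + d)) => h.
- by have := aux _ b _ d (leq_addl a b) h; rewrite E ltnn.
- by have := aux _ d _ b (leq_addl c d) h; rewrite E ltnn.
- move: E; rewrite h => /addnI bd; split=> //.
  by move: h; rewrite bd => /addIn.
Qed.

Lemma holds_Perfect_bin T : holds Perfect_bin T <-> perfect_bin_statement T.
Proof.
split=> [H s sT sE | H a Ha].
- have [|c Hc] := H (strcode s).
    by move=> b; exists s; split=> //; apply: sE.
  have [s0 [t [/strcode_inj e0 ec tT ti _]]] := Hc 0; subst s0.
  exists t; split=> //; try by move=> i; case: (tT i).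
  move=> i l; have [s1 [u [_ ec' _ _ Hu]]] := Hc l.
  have [/strcode_inj e1 /strcode_inj e2] := cpair_inj (etrans (esym ec) ec').
  by case: i; rewrite ?e1 ?e2.
- have [s [ea sT _]] := Ha 0.
  have sE : Ext s T.
    by move=> l; have [s' [e _ h]] := Ha l; rewrite (strcode_inj (etrans (esym ea) e)).
  have [t [tT tp ti tE]] := H s sT sE.
  exists (cpair (strcode (t false)) (strcode (t true))) => d.
  by exists s, t; split=> // i; apply: tE.
Qed.

(* Main.v *)
Require Import Defs.
From mathcomp Require Import all_boot.
From mathcomp Require Import zify.
From Stdlib Require Import Classical_Pred_Type.

Set Implicit Arguments.
Unset Strict Implicit.
Unset Printing Implicit Defensive.

(* [Perfect_bin] is itself equivalent to a formula in the required normal form, so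
   it suffices to reduce an arbitrary "forall a, (forall b, gamma) -> exists c,
   forall d, theta" to it. Consider the tree of all strings 0^n, 0^n 1 and 0^n 1
   1 r, together with those strings 0^a 1 0 r such that gamma(a,b) holds for all
   b < |r| and such that, if r = 0^e 1 t, theta(a,c(e),d) holds for all d < |t|,
   where c(e), implemented as [csnd e], takes every value infinitely often. A
   node 0^a 1 0 r is extendible iff gamma(a,b) holds for all b and, when r = 0^e
   1 t, theta(a,c(e),d) holds for all d. Hence the only nodes that may be
   extendible without splitting are the 0^a 1 0 0^n with a satisfying the
   premise; a witness c for a splits all of them at some e >= n with c(e) = c,
   and conversely two incomparable extendible nodes above 0^a 1 0 are not both
   of the form 0^a 1 0 0^n, so that one of them yields an e for which c(e) is a
   witness for a. All the functionals involved are primitive recursive in the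
   oracles. *)

(** * Primitive recursive functions with oracles *)

Scheme eval_evals_ind := Minimality for eval Sort Prop
with evals_eval_ind := Minimality for evals Sort Prop.

(** An oracle reads the head of an argument list of any length, whereas [p] is only known on one
    argument; hence the composition with [CProj 0]. Oracles other than 0 read as 0 when the oracle
    list is [[:: x]]. *)
Fixpoint subst_oracle (p c : code) : code :=
  match c with
  | COracle i => if i is 0 then CComp p [:: CProj 0] else CZero
  | CComp f gs => CComp (subst_oracle p f) (map (subst_oracle p) gs)
  | CPrec f g => CPrec (subst_oracle p f) (subst_oracle p g)
  | CMu f => CMu (subst_oracle p f)
  | _ => c
  end.

Lemma eval_subst_oracle p x c v r : computes p [::] x ->
  eval [:: x] c v r -> eval [::] (subst_oracle p c) v r.
Proof.
move=> px; pose Q gs v ws := evals [::] (map (subst_oracle p) gs) v ws.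
apply: (@eval_evals_ind _ (fun c v r => eval [::] (subst_oracle p c) v r) Q).
- exact: EvZero.
- exact: EvSucc.
- exact: EvProj.
- move=> [|i] w /=; last by rewrite nth_default //; exact: EvZero.
  apply: EvComp (px _); apply: EvCons (EvNil _ _).
  by rewrite -nth0; exact: EvProj.
- by move=> f gs w ws s _ IHgs _ IHf; exact: EvComp IHgs IHf.
- by move=> f g w s _ IH; exact: EvPrec0.
- by move=> f g n w s t _ IH1 _ IH2; exact: EvPrecS IH1 IH2.
- by move=> f w n s _ IH0 _ IH; exact: (EvMu (r := s)).
- by move=> w; exact: EvNil.
- by move=> g gs w u us _ IH1 _ IH2; exact: EvCons.
Qed.

(** Inlining a program for [x] removes the oracle. This keeps the image of an instance computable,
    as instances must be. *)
Lemma computable_computes c x y :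
  computable x -> computes c [:: x] y -> computable y.
Proof.
by move=> [p px] cy; exists (subst_oracle p c) => n; apply: eval_subst_oracle px _.
Qed.

(** Only one program, uniform in the oracles and total on lists of length [N], is asked for. The
    closure lemmas below build such programs without [CMu]. *)
Definition primrec N (f : seq baire -> seq nat -> nat) : Prop :=
  exists c, forall o v, size v = N -> eval o c v (f o v).

Definition primrecb N (p : seq baire -> seq nat -> bool) : Prop :=
  primrec N (fun o v => nat_of_bool (p o v)).

Lemma primrec_ext N f g :
  (forall o v, f o v = g o v) -> primrec N f -> primrec N g.
Proof. by move=> fg [c cf]; exists c => o v vN; rewrite -fg; exact: cf. Qed.

Lemma primrecb_ext N f g :
  (forall o v, f o v = g o v) -> primrecb N f -> primrecb N g.
Proof. by move=> fg; apply: primrec_ext => o v; rewrite fg. Qed.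

Lemma evals_projs o v m n : m + n = size v ->
  evals o (map CProj (iota m n)) v (drop m v).
Proof.
elim: n m => [|n IH] m mn.
  by rewrite -(addn0 m) mn drop_size; exact: EvNil.
rewrite (drop_nth 0) /=; last by rewrite -mn addnS ltnS leq_addr.
by apply: EvCons; [exact: EvProj | apply: IH; rewrite addSnnS].
Qed.

Lemma primrec_weaken N f : primrec N f -> primrec N.+1 (fun o v => f o (behead v)).
Proof.
move=> [c cf]; exists (CComp c (map CProj (iota 1 N))) => o v vN.
apply: EvComp (cf o (behead v) _); last by rewrite size_behead vN.
by rewrite -drop1; apply: evals_projs; rewrite vN.
Qed.

Lemma primrec_nth N i : primrec N (fun _ v => nth 0 v i).
Proof. by exists (CProj i) => o v _; exact: EvProj. Qed.

Lemma primrec_nth1 N i : primrec N (fun _ v => nth 0 (behead v) i).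
Proof. by apply: primrec_ext (primrec_nth N i.+1) => _ v; rewrite nth_behead. Qed.

Lemma primrec_nth2 N i : primrec N (fun _ v => nth 0 (behead (behead v)) i).
Proof. by apply: primrec_ext (primrec_nth N i.+2) => _ v; rewrite !nth_behead. Qed.

Lemma primrec_comp1 N f F : primrec N f -> primrec 1 F ->
  primrec N (fun o v => F o [:: f o v]).
Proof.
move=> [c cf] [d dF]; exists (CComp d [:: c]) => o v vN.
by apply: EvComp (dF _ _ _) => //; do !constructor; exact: cf.
Qed.

Lemma primrec_comp2 N f g F : primrec N f -> primrec N g -> primrec 2 F ->
  primrec N (fun o v => F o [:: f o v; g o v]).
Proof.
move=> [c cf] [c' cg] [d dF]; exists (CComp d [:: c; c']) => o v vN.
by apply: EvComp (dF _ _ _) => //; do !constructor; [exact: cf | exact: cg].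
Qed.

Lemma primrec_comp3 N f g h F : primrec N f -> primrec N g -> primrec N h ->
  primrec 3 F -> primrec N (fun o v => F o [:: f o v; g o v; h o v]).
Proof.
move=> [c cf] [c' cg] [c2 ch] [d dF]; exists (CComp d [:: c; c'; c2]) => o v vN.
by apply: EvComp (dF _ _ _) => //; do !constructor; [exact: cf|exact: cg|exact: ch].
Qed.

Lemma primrec_succ N f : primrec N f -> primrec N (fun o v => (f o v).+1).
Proof.
move=> nf; apply: (primrec_comp1 (F := fun _ v => (head 0 v).+1)) => //.
by exists CSucc => o v _; exact: EvSucc.
Qed.

Lemma primrec_const N k : primrec N (fun _ _ => k).
Proof.
elim: k => [|k IH]; last exact: primrec_succ.
by exists CZero => o v _; exact: EvZero.
Qed.

Lemma primrec_oracle N i f : primrec N f ->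
  primrec N (fun o v => nth (fun=> 0) o i (f o v)).
Proof.
move=> nf; apply: (primrec_comp1 (F := fun o v => nth (fun=> 0) o i (head 0 v))) => //.
by exists (COracle i) => o v _; exact: EvOracle.
Qed.

(** This is [CPrec] in the form of an iteration: the step finds the counter at position 0, the
    previous value at position 1 and the parameters behind them. *)
Lemma primrec_iteri N n b s : primrec N n -> primrec N b ->
  primrec N.+2 (fun o v => s o (behead (behead v)) (nth 0 v 0) (nth 0 v 1)) ->
  primrec N (fun o v => iteri (n o v) (s o v) (b o v)).
Proof.
move=> [cn nP] [cb bP] [cs sP].
exists (CComp (CPrec cb cs) (cn :: map CProj (iota 0 N))) => o v vN.
apply: (EvComp (ws := n o v :: v)).
  by apply: EvCons; [exact: nP | rewrite -{2}(drop0 v); apply: evals_projs].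
elim: (n o v) => [|k IH]; first by apply: EvPrec0; exact: bP.
by apply: EvPrecS IH _; apply: (sP o [:: k, _ & v]); rewrite /= vN.
Qed.

Lemma primrec_pred N f : primrec N f -> primrec N (fun o v => (f o v).-1).
Proof.
move=> nf; apply: primrec_ext (primrec_iteri (s := fun _ _ k _ => k) nf
  (primrec_const N 0) (primrec_nth _ _)) => o v /=; by case: (f o v).
Qed.

Lemma primrec_add N f g : primrec N f -> primrec N g ->
  primrec N (fun o v => f o v + g o v).
Proof.
move=> nf ng; apply: primrec_ext (primrec_iteri (s := fun _ _ _ r => r.+1) ng nf
  (primrec_succ (primrec_nth _ _))) => o v /=.
by elim: (g o v) => [|k /= ->]; rewrite ?addn0 ?addnS.
Qed.

Lemma primrec_sub N f g : primrec N f -> primrec N g ->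
  primrec N (fun o v => f o v - g o v).
Proof.
move=> nf ng; apply: primrec_ext (primrec_iteri (s := fun _ _ _ r => r.-1) ng nf
  (primrec_pred (primrec_nth _ _))) => o v /=.
by elim: (g o v) => [|k /= ->]; rewrite ?subn0 ?subnS.
Qed.

Lemma primrec_mul N f g : primrec N f -> primrec N g ->
  primrec N (fun o v => f o v * g o v).
Proof.
move=> nf ng; apply: primrec_ext (primrec_iteri (s := fun o v _ r => r + f o v) ng
  (primrec_const N 0) (primrec_add (primrec_nth _ _)
    (primrec_weaken (primrec_weaken nf)))) => o v /=.
by elim: (g o v) => [|k /= ->]; rewrite ?muln0 ?mulnSr.
Qed.

Lemma primrec_exp N f g : primrec N f -> primrec N g ->
  primrec N (fun o v => f o v ^ g o v).
Proof.
move=> nf ng; apply: primrec_ext (primrec_iteri (s := fun o v _ r => r * f o v) ng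
  (primrec_const N 1) (primrec_mul (primrec_nth _ _)
    (primrec_weaken (primrec_weaken nf)))) => o v /=.
by elim: (g o v) => [|k /= ->]; rewrite ?expnSr.
Qed.

(** Recursion along [(k.+1)./2 = k - k./2]. *)
Lemma primrec_half N f : primrec N f -> primrec N (fun o v => (f o v)./2).
Proof.
move=> nf; apply: primrec_ext (primrec_iteri (s := fun _ _ k r => k - r) nf
  (primrec_const N 0) (primrec_sub (primrec_nth _ _) (primrec_nth _ _))) => o v /=.
by elim: (f o v) => [|k /= ->] //; lia.
Qed.

Lemma primrecb_odd N f : primrec N f -> primrecb N (fun o v => odd (f o v)).
Proof.
move=> nf; apply: primrec_ext (primrec_iteri (s := fun _ _ k r => 1 - r) nf
  (primrec_const N 0) (primrec_sub (primrec_const _ 1) (primrec_nth _ _))) => o v /=.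
by elim: (f o v) => [|k /= ->] //; case: (odd k).
Qed.

(** The truth value serves as the number of iterations: none leaves the start value [g], one
    replaces it by [f]. *)
Lemma primrec_if N p f g : primrecb N p -> primrec N f -> primrec N g ->
  primrec N (fun o v => if p o v then f o v else g o v).
Proof.
move=> np nf ng; apply: primrec_ext (primrec_iteri (s := fun o v _ _ => f o v) np ng
  (primrec_weaken (primrec_weaken nf))) => o v /=; by case: (p o v).
Qed.

Lemma primrecb_neg N p : primrecb N p -> primrecb N (fun o v => ~~ p o v).
Proof.
move=> np; apply: primrec_ext (primrec_sub (primrec_const N 1) np) => o v.
by case: (p o v).
Qed.

Lemma primrecb_and N p q : primrecb N p -> primrecb N q ->
  primrecb N (fun o v => p o v && q o v).
Proof.
move=> np nq; apply: primrec_ext (primrec_mul np nq) => o v.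
by case: (p o v); case: (q o v).
Qed.

Lemma primrecb_or N p q : primrecb N p -> primrecb N q ->
  primrecb N (fun o v => p o v || q o v).
Proof.
move=> np nq; apply: primrecb_ext
  (primrecb_neg (primrecb_and (primrecb_neg np) (primrecb_neg nq))) => o v.
by rewrite negb_and !negbK.
Qed.

Lemma primrecb_leq N f g : primrec N f -> primrec N g ->
  primrecb N (fun o v => f o v <= g o v).
Proof.
move=> nf ng; apply: primrec_ext
  (primrec_sub (primrec_const N 1) (primrec_sub nf ng)) => o v.
by rewrite /leq; case: (f o v - g o v).
Qed.

Lemma primrecb_eq N f g : primrec N f -> primrec N g ->
  primrecb N (fun o v => f o v == g o v).
Proof.
move=> nf ng; apply: primrecb_ext
  (primrecb_and (primrecb_leq nf ng) (primrecb_leq ng nf)) => o v.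
by rewrite eqn_leq.
Qed.

(** Lets a predicate of counter and parameters be used inside an iteration step, where the previous
    value stands between them. *)
Lemma primrec_drop_second N f : primrec N.+1 f ->
  primrec N.+2 (fun o v => f o (nth 0 v 0 :: behead (behead v))).
Proof.
move=> [c cf]; exists (CComp c (CProj 0 :: map CProj (iota 2 N))) => o v vN.
apply: EvComp (cf o _ _); last by rewrite /= !size_behead vN.
apply: EvCons; first exact: EvProj.
by rewrite -!drop1 drop_drop; apply: evals_projs; rewrite vN.
Qed.

Lemma primrec_find N n p : primrec N n ->
  primrecb N.+1 (fun o v => p o (behead v) (nth 0 v 0)) ->
  primrec N (fun o v => find (p o v) (iota 0 (n o v))).
Proof.
(* After [k] rounds the value [r] is the result of the search below [k]: [r < k] means found, and
   otherwise [r = k]. *)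
move=> nn np; pose s o v k r := if r < k then r else k + ~~ p o v k.
apply: primrec_ext (primrec_iteri (s := s) nn (primrec_const N 0) _) => [o v|].
  elim: (n o v) => [|k IH] //; rewrite -[in RHS]addn1 [in RHS]iotaD find_cat /= IH /s.
  rewrite has_find size_iota; case: ltnP => // kf.
  by case: (p o v k); rewrite ?addn0.
apply: primrec_if.
  exact: primrecb_leq (primrec_succ (primrec_nth _ _)) (primrec_nth _ _).
  exact: primrec_nth.
apply: primrec_add; first exact: primrec_nth.
by apply: primrecb_neg; exact: primrec_drop_second np.
Qed.

Lemma primrecb_has N n p : primrec N n ->
  primrecb N.+1 (fun o v => p o (behead v) (nth 0 v 0)) ->
  primrecb N (fun o v => has (p o v) (iota 0 (n o v))).
Proof.
move=> nn np; apply: primrecb_ext (primrecb_leq (primrec_succ (primrec_find nn np)) nn).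
by move=> o v; rewrite has_find size_iota.
Qed.

Lemma primrecb_all N n p : primrec N n ->
  primrecb N.+1 (fun o v => p o (behead v) (nth 0 v 0)) ->
  primrecb N (fun o v => all (p o v) (iota 0 (n o v))).
Proof.
move=> nn np; apply: primrecb_ext
  (primrecb_neg (primrecb_has (p := fun o v k => ~~ p o v k) nn (primrecb_neg np))).
by move=> o v; rewrite -all_predC; apply: eq_all => k /=; rewrite negbK.
Qed.

(** * Evaluation of terms and bounded formulas *)

Lemma primrec_tval N t : primrec N (fun o v => Defs.tval (nth (fun=> 0) o 0) v t).
Proof.
elim: t => /= *; do ?[exact: primrec_nth | exact: primrec_const
  | exact: primrec_succ | exact: primrec_add | exact: primrec_mul
  | exact: primrec_exp | exact: primrec_oracle].
Qed.

Lemma primrecb_bsat N F : primrecb N (fun o v => bsat (nth (fun=> 0) o 0) v F).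
Proof.
elim: F N => /= [t u|t u|F IHF|F IHF G IHG|F IHF G IHG|t F IHF|t F IHF] N.
- by apply: primrecb_eq; exact: primrec_tval.
- by apply: primrecb_leq; [apply: primrec_succ|]; exact: primrec_tval.
- exact: primrecb_neg.
- exact: primrecb_and.
- exact: primrecb_or.
- apply: primrecb_ext (primrecb_all
    (p := fun o v k => bsat (nth (fun=> 0) o 0) (k :: v) F) (primrec_tval N t) _) => [o v|].
    apply/allP/forallP => [h k|h k]; first by apply: h; rewrite mem_iota ltn_ord.
    by rewrite mem_iota => kt; exact: (h (Ordinal kt)).
  (* The list has length [N.+1], hence is nonempty, and is then recovered from its head and its
     tail. *)
  have [c cF] := IHF N.+1; exists c => o [|k v] // vN; exact: cF.
- apply: primrecb_ext (primrecb_has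
    (p := fun o v k => bsat (nth (fun=> 0) o 0) (k :: v) F) (primrec_tval N t) _) => [o v|].
    apply/hasP/existsP => [[k]|[k h]]; last by exists (val k); rewrite ?mem_iota ?ltn_ord.
    by rewrite mem_iota => kt h; exists (Ordinal kt).
  have [c cF] := IHF N.+1; exists c => o [|k v] // vN; exact: cF.
Qed.

(** * Pairs and strings *)

Lemma find_iota (P : pred nat) n a :
  P a -> a < n -> (forall k, k < a -> ~~ P k) -> find P (iota 0 n) = a.
Proof.
move=> Pa an H; have /(nth_find 0) : has P (iota 0 n).
  by apply/hasP; exists a => //; rewrite mem_iota.
set k := find _ _; have kn : k < n.
  by rewrite -[n](size_iota 0) -has_find; apply/hasP; exists a; rewrite ?mem_iota.
rewrite nth_iota // => Pk; case: (ltngtP k a) => // [/H|ak]; first by rewrite Pk.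
by have := before_find 0 ak; rewrite nth_iota // add0n Pa.
Qed.

(** Inverting the pairing by bounded search makes primitive recursiveness immediate; the bound
    suffices by [leq_cpair]. *)
Definition cfst m :=
  find (fun a => has (fun b => cpair a b == m) (iota 0 m.+1)) (iota 0 m.+1).

Definition csnd m :=
  find (fun b => has (fun a => cpair a b == m) (iota 0 m.+1)) (iota 0 m.+1).

Lemma leq_cpair a b : a + b <= cpair a b.
Proof.
rewrite /cpair; apply: leq_trans (leq_addr _ _).
case: (a + b) => // s; rewrite -{1}(doubleK s.+1); apply: half_leq.
by rewrite -muln2 leq_mul.
Qed.

Lemma cfst_cpair a b : cfst (cpair a b) = a.
Proof.
have := leq_cpair a b => ab; apply: find_iota => [||k ka].
- by apply/hasP; exists b => //; rewrite mem_iota; lia.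
- lia.
- by apply/hasPn => q _; apply: contraTneq ka => /cpair_inj[-> _]; rewrite ltnn.
Qed.

Lemma csnd_cpair a b : csnd (cpair a b) = b.
Proof.
have := leq_cpair a b => ab; apply: find_iota => [||k ka].
- by apply/hasP; exists a => //; rewrite mem_iota; lia.
- lia.
- by apply/hasPn => q _; apply: contraTneq ka => /cpair_inj[_ ->]; rewrite ltnn.
Qed.

(** The first digit of [n.+1] is given by [odd n], and the rest of the string has code [n./2]. The
    Boolean equation allows [xchoose] to pick the string. *)
Lemma strcode_surj n : exists s, strcode s == n.
Proof.
elim/ltn_ind: n => -[_|n IH]; first by exists [::].
have [|s /eqP sn] := IH n./2; first by lia.
by exists (odd n :: s); rewrite /= sn; apply/eqP; lia.
Qed.

Definition strdecode n : seq bool := xchoose (strcode_surj n).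

Lemma strdecodeK n : strcode (strdecode n) = n.
Proof. exact/eqP/(xchooseP (strcode_surj n)). Qed.

Lemma strcodeK s : strdecode (strcode s) = s.
Proof. by apply: strcode_inj; rewrite strdecodeK. Qed.

Lemma strcode_behead s : strcode (behead s) = (strcode s).-1./2.
Proof. by case: s => [|[] s] //=; lia. Qed.

Lemma strcode_drop k s : strcode (drop k s) = iteri k (fun _ m => m.-1./2) (strcode s).
Proof.
elim: k => [|k /= <-]; first by rewrite drop0.
by rewrite -strcode_behead -drop1 drop_drop.
Qed.

Lemma strcode_cat s t : strcode (s ++ t) = strcode s + 2 ^ size s * strcode t.
Proof.
elim: s => [|b s IH] /=; first by rewrite mul1n.
by rewrite IH expnS; lia.
Qed.

Lemma strcode_nseq0 n : strcode (nseq n false) = 2 ^ n - 1.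
Proof. by elim: n => //= n ->; rewrite expnS; have := expn_gt0 2 n; lia. Qed.

Lemma strcode_eq0 s : (strcode s == 0) = (s == [::]).
Proof. by case: s => [|b s] /=; rewrite ?addnS ?[_.*2 + _]addnC ?half_bit_double. Qed.

(** The letters [false] and [true] are the digits 1 and 2, and the empty string has the even code 0;
    hence the default [true]. *)
Lemma odd_strcode s : odd (strcode s) = ~~ head true s.
Proof. by case: s => [|[] s] //=; lia. Qed.

Lemma size_leq_strcode s : size s <= strcode s.
Proof. by elim: s => //= b s IH; lia. Qed.

Lemma size_strcodeE s :
  size s = find (fun k => strcode (drop k s) == 0) (iota 0 (strcode s).+1).
Proof.
rewrite (@find_iota _ _ (size s)) // ?drop_size // => [|k ks].
  by rewrite ltnS size_leq_strcode.
by rewrite strcode_eq0 -size_eq0 size_drop subn_eq0 -ltnNge.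
Qed.

(** The code of a suffix is even as soon as the suffix begins with [true] or is empty, so a string
    without [true] correctly yields its length. *)
Lemma index_true_strcodeE s :
  index true s = find (fun k => ~~ odd (strcode (drop k s))) (iota 0 (strcode s).+1).
Proof.
rewrite (@find_iota _ _ (index true s)) // => [||k ks].
- rewrite odd_strcode negbK; elim: s => //= -[] s IH //.
- by rewrite ltnS (leq_trans (index_size _ _)) ?size_leq_strcode.
- have kz : k < size s by apply: leq_trans ks (index_size _ _).
  rewrite odd_strcode negbK (drop_nth true) //=.
  by have /= := before_find true ks; case: (nth true s k).
Qed.

(** * Primitive recursive operations on pairs and strings *)

Definition primrecs N (f : seq baire -> seq nat -> seq bool) : Prop :=
  primrec N (fun o v => strcode (f o v)).

Lemma primrec_cpair N f g : primrec N f -> primrec N g ->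
  primrec N (fun o v => cpair (f o v) (g o v)).
Proof.
move=> nf ng; apply: primrec_add => //; apply: primrec_half.
by apply: primrec_mul; [|apply: primrec_succ]; apply: primrec_add.
Qed.

Lemma primrec_cfst N f : primrec N f -> primrec N (fun o v => cfst (f o v)).
Proof.
move=> nf; apply: (primrec_comp1 (F := fun _ v => cfst (nth 0 v 0))) => //.
apply: primrec_find; first exact/primrec_succ/primrec_nth.
apply: (primrecb_has (p := fun o v b => cpair (nth 0 v 0) b == nth 0 (behead v) 0)
  (n := fun o v => (nth 0 (behead v) 0).+1)).
  exact/primrec_succ/primrec_nth1.
apply: primrecb_eq; last exact: primrec_nth2.
by apply: primrec_cpair; [exact: primrec_nth1 | exact: primrec_nth].
Qed.

Lemma primrec_csnd N f : primrec N f -> primrec N (fun o v => csnd (f o v)).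
Proof.
move=> nf; apply: (primrec_comp1 (F := fun _ v => csnd (nth 0 v 0))) => //.
apply: primrec_find; first exact/primrec_succ/primrec_nth.
apply: (primrecb_has (p := fun o v a => cpair a (nth 0 v 0) == nth 0 (behead v) 0)
  (n := fun o v => (nth 0 (behead v) 0).+1)).
  exact/primrec_succ/primrec_nth1.
apply: primrecb_eq; last exact: primrec_nth2.
by apply: primrec_cpair; [exact: primrec_nth | exact: primrec_nth1].
Qed.

Lemma primrecs_decode N f : primrec N f -> primrecs N (fun o v => strdecode (f o v)).
Proof. by move=> nf; apply: primrec_ext nf => o v; rewrite strdecodeK. Qed.

Lemma primrecs_const N s : primrecs N (fun _ _ => s).
Proof. exact: primrec_const. Qed.

Lemma primrecs_behead N f : primrecs N f -> primrecs N (fun o v => behead (f o v)).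
Proof.
move=> nf; apply: primrec_ext (primrec_half (primrec_pred nf)) => o v.
by rewrite strcode_behead.
Qed.

Lemma primrecs_drop N k f : primrec N k -> primrecs N f ->
  primrecs N (fun o v => drop (k o v) (f o v)).
Proof.
move=> nk nf; apply: primrec_ext (primrec_iteri (s := fun _ _ _ m => m.-1./2) nk nf _).
  by move=> o v; rewrite strcode_drop.
exact/primrec_half/primrec_pred/primrec_nth.
Qed.

Lemma primrecb_head N f : primrecs N f -> primrecb N (fun o v => head true (f o v)).
Proof.
move=> nf; apply: primrecb_ext (primrecb_neg (primrecb_odd nf)) => o v.
by rewrite odd_strcode negbK.
Qed.

Lemma primrec_size N f : primrecs N f -> primrec N (fun o v => size (f o v)).
Proof.
move=> nf; apply: (primrec_ext (f := fun o v => size (strdecode (strcode (f o v))))).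
  by move=> o v; rewrite strcodeK.
apply: (primrec_comp1 (F := fun _ v => size (strdecode (nth 0 v 0)))) => //.
apply: primrec_ext (primrec_find (n := fun _ v => (nth 0 v 0).+1)
  (p := fun _ v k => strcode (drop k (strdecode (nth 0 v 0))) == 0) _ _) => [o v||].
- by rewrite size_strcodeE strdecodeK.
- exact/primrec_succ/primrec_nth.
- apply: primrecb_eq; last exact: primrec_const.
  by apply: primrecs_drop; [exact: primrec_nth | exact/primrecs_decode/primrec_nth1].
Qed.

Lemma primrec_index_true N f : primrecs N f -> primrec N (fun o v => index true (f o v)).
Proof.
move=> nf.
apply: (primrec_ext (f := fun o v => index true (strdecode (strcode (f o v))))).
  by move=> o v; rewrite strcodeK.
apply: (primrec_comp1 (F := fun _ v => index true (strdecode (nth 0 v 0)))) => //.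
apply: primrec_ext (primrec_find (n := fun _ v => (nth 0 v 0).+1)
  (p := fun _ v k => ~~ odd (strcode (drop k (strdecode (nth 0 v 0))))) _ _) => [o v||].
- by rewrite index_true_strcodeE strdecodeK.
- exact/primrec_succ/primrec_nth.
- apply: primrecb_neg; apply: primrecb_odd.
  by apply: primrecs_drop; [exact: primrec_nth | exact/primrecs_decode/primrec_nth1].
Qed.

Lemma primrecb_mem_true N f : primrecs N f -> primrecb N (fun o v => true \in f o v).
Proof.
move=> nf; apply: primrecb_ext
  (primrecb_leq (primrec_succ (primrec_index_true nf)) (primrec_size nf)) => o v.
by rewrite index_mem.
Qed.

Lemma primrecs_cat N f g : primrecs N f -> primrecs N g ->
  primrecs N (fun o v => f o v ++ g o v).
Proof.
move=> nf ng; apply: primrec_ext (primrec_add nf (primrec_mul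
  (primrec_exp (primrec_const N 2) (primrec_size nf)) ng)) => o v.
by rewrite strcode_cat.
Qed.

Lemma primrecs_nseq0 N n : primrec N n -> primrecs N (fun o v => nseq (n o v) false).
Proof.
move=> nn; apply: primrec_ext (primrec_sub
  (primrec_exp (primrec_const N 2) nn) (primrec_const N 1)) => o v.
by rewrite strcode_nseq0.
Qed.

(** * [Perfect_bin] in normal form *)

(** The strings of length [k] have the codes from 2^k - 1 to 2^(k+1) - 2. Thus exponentiation
    expresses the length, and quantifiers over strings of a given length are bounded. *)
Lemma size_strcode_eq s k :
  (size s == k) = (2 ^ k < (strcode s).+2) && ((strcode s).+1 < 2 ^ k.+1).
Proof.
have [lo hi] : 2 ^ size s < (strcode s).+2 /\ (strcode s).+1 < 2 ^ (size s).+1.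
  by elim: s => //= b s [IH1 IH2]; rewrite !expnS in IH1 IH2 *; lia.
case: (ltngtP (size s) k) => [sk|ks|<-]; last by rewrite lo hi.
  by apply/esym/negbTE; have := @leq_pexp2l 2 _ _ isT sk; lia.
by apply/esym/negbTE; have := @leq_pexp2l 2 _ _ isT ks; lia.
Qed.

Definition tone := TSucc TZero.
Definition ttwo := TSucc tone.

Definition size_form (t k : term) : bformula :=
  BAnd (BLt (TExp ttwo k) (TSucc (TSucc t))) (BLt (TSucc t) (TExp ttwo (TSucc k))).

(* Binds the length of the string coded by variable [i], as variable 0. *)
Definition with_size i (F : bformula) : bformula :=
  BEx (TSucc (TVar i)) (BAnd (size_form (TVar i.+1) (TVar 0)) F).

(* In [cat_term i k], the variables [i] and [k] hold a string and its length. *)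
Definition cat_term i k (t : term) : term :=
  TAdd (TVar i) (TMul (TExp ttwo (TVar k)) t).

Definition prefix_form i k j : bformula :=
  BEx (TSucc (TVar j)) (BEq (TVar j.+1) (cat_term i.+1 k.+1 (TVar 0))).

Definition in_tree_form (t : term) : bformula := BEq (TApp t) tone.

Definition ext_form i k l : bformula :=
  BEx (TExp ttwo (TSucc (TVar l)))
    (BAnd (size_form (TVar 0) (TVar l.+1))
          (in_tree_form (cat_term i.+1 k.+1 (TVar 0)))).

Lemma bsat_with_size x v i s F : nth 0 v i = strcode s ->
  bsat x v (with_size i F) = bsat x (size s :: v) F.
Proof.
move=> vi; apply/existsP/idP => /= [[[k /= _]]|F1].
  by rewrite vi -size_strcode_eq => /andP[/eqP->].
have sl : size s < (nth 0 v i).+1 by rewrite vi ltnS size_leq_strcode.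
by exists (Ordinal sl); rewrite /= vi -size_strcode_eq eqxx.
Qed.

Lemma bsat_prefix_form x v i k j s t :
  nth 0 v i = strcode s -> nth 0 v k = size s -> nth 0 v j = strcode t ->
  bsat x v (prefix_form i k j) = prefix s t.
Proof.
move=> vi vk vj; apply/existsP/prefixP => /= [[[m /= _]]|[u tE]].
  rewrite vi vk vj -{1}(strdecodeK m) -strcode_cat => /eqP/strcode_inj ->.
  by exists (strdecode m).
have ul : strcode u < (nth 0 v j).+1.
  by rewrite vj tE strcode_cat; have := expn_gt0 2 (size s); nia.
by exists (Ordinal ul); rewrite /= vi vk vj -strcode_cat tE.
Qed.

Lemma bsat_ext_form x v i k l s n :
  nth 0 v i = strcode s -> nth 0 v k = size s -> nth 0 v l = n ->
  bsat x v (ext_form i k l) <-> exists t : n.-tuple bool, in_tree x (s ++ t).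
Proof.
move=> vi vk vl; split=> [/existsP[[m /= _]]|[t xt]].
  rewrite vi vk vl -{1 2 3}(strdecodeK m) -size_strcode_eq -strcode_cat.
  case/andP=> mn /eqP xm.
  by exists (Tuple mn).
have : strcode t < 2 ^ (nth 0 v l).+1.
  have := size_strcode_eq t n; rewrite size_tuple eqxx vl; lia.
move=> ul; apply/existsP; exists (Ordinal ul) => /=.
by rewrite vi vk vl -size_strcode_eq size_tuple eqxx -strcode_cat xt.
Qed.

(** The language of terms has no halving, so pairing is expressed through its double; the product of
    two successive numbers is even. *)
Lemma cpair_double a b : cpair a b + cpair a b = (a + b) * (a + b).+1 + (b + b).
Proof.
rewrite /cpair; set m := _ * _; have := odd_double_half m.
by rewrite /m oddM /= andbN -/m; lia.
Qed.

(** Inside [with_size] the variables are the length of the string coded by a, then a, then b. *)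
Definition gamma_form : bformula :=
  with_size 0 (BAnd (in_tree_form (TVar 1)) (ext_form 1 0 2)).

(* The variables are q, p, a, c, d, preceded in the conjunction by the lengths of
   the strings coded by q, p and a. *)
Definition splits_form : bformula :=
  with_size 2 (with_size 2 (with_size 2 (BAnd
    (BAnd (BAnd (in_tree_form (TVar 4)) (in_tree_form (TVar 3)))
          (BAnd (prefix_form 5 2 4) (prefix_form 5 2 3)))
    (BAnd (BAnd (BNot (prefix_form 4 1 3)) (BNot (prefix_form 3 0 4)))
          (BAnd (ext_form 4 1 7) (ext_form 3 0 7)))))).

Definition theta_form : bformula :=
  BEx (TSucc (TVar 1)) (BEx (TSucc (TVar 2)) (BAnd
    (BEq (TAdd (TVar 3) (TVar 3))
      (TAdd (TMul (TAdd (TVar 1) (TVar 0)) (TSucc (TAdd (TVar 1) (TVar 0))))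
            (TAdd (TVar 0) (TVar 0))))
    splits_form)).

Lemma bsat_splits_form x s p q c d :
  bsat x [:: strcode q; strcode p; strcode s; c; d] splits_form <->
  [/\ (in_tree x p /\ prefix s p) /\ (in_tree x q /\ prefix s q), incomparable p q,
      exists u : d.-tuple bool, in_tree x (p ++ u)
    & exists u : d.-tuple bool, in_tree x (q ++ u)].
Proof.
rewrite (bsat_with_size x (s := s)) // (bsat_with_size x (s := p)) //.
rewrite (bsat_with_size x (s := q)) //.
set v := [:: size q, _ & _].
(* Stated for arbitrary conjuncts, so that simplification does not unfold the eight subformulas. *)
have -> F1 F2 F3 F4 F5 F6 F7 F8 : bsat x v (BAnd
    (BAnd (BAnd F1 F2) (BAnd F3 F4)) (BAnd (BAnd (BNot F5) (BNot F6)) (BAnd F7 F8))) =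
    [&& bsat x v F1, bsat x v F2, bsat x v F3, bsat x v F4
      & [&& ~~ bsat x v F5, ~~ bsat x v F6, bsat x v F7 & bsat x v F8]].
  by rewrite /= -!andbA.
rewrite (bsat_prefix_form x (s := s) (t := p)) //
  (bsat_prefix_form x (s := s) (t := q)) //.
rewrite (bsat_prefix_form x (s := p) (t := q)) //
  (bsat_prefix_form x (s := q) (t := p)) //.
have pE := @bsat_ext_form x v 4 1 7 p d erefl erefl erefl.
have qE := @bsat_ext_form x v 3 0 7 q d erefl erefl erefl.
split.
  case/and5P=> /eqP xp /eqP xq sp sq /and4P[pq qp /pE eP /qE eQ].
  by split=> //; exact/andP.
case=> [[[xp sp] [xq sq]] /andP[pq qp] /pE eP /qE eQ].
by rewrite sp sq pq qp eP eQ !andbT; apply/andP; split; exact/eqP.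
Qed.

Lemma Perfect_bin_is_AE_formula : is_AE_formula Perfect_bin.
Proof.
exists gamma_form, theta_form; split=> [a b x|a c d x].
  rewrite -(strdecodeK a); set s := strdecode a.
  rewrite (bsat_with_size x (s := s)) //; split=> [[t [/strcode_inj <- xs ext]]|].
    apply/andP; split; first exact/eqP.
    by apply/(bsat_ext_form x (s := s) (n := b)).
  case/andP=> /eqP xs /(bsat_ext_form x (s := s) (n := b)) ext.
  by exists s; split=> //; exact: ext.
split.
  case=> s [t [-> -> tT tpq tE]].
  have := leq_cpair (strcode (t false)) (strcode (t true)); set c' := cpair _ _ => lec.
  have p_lt : strcode (t false) < c'.+1 by lia.
  have q_lt : strcode (t true) < c'.+1 by lia.
  apply/existsP; exists (Ordinal p_lt); apply/existsP; exists (Ordinal q_lt).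
  apply/andP; split; first by apply/eqP; exact: cpair_double.
  by apply/(bsat_splits_form x s); split; [split; apply: tT | | exact: tE | exact: tE].
case/existsP=> p /existsP[q] /andP[/eqP /= cE].
have {}cE : c = cpair p q.
  by have := cpair_double p q; rewrite -cE !addnn => /double_inj.
rewrite -(strdecodeK a) -(strdecodeK p) -(strdecodeK q).
move=> sat; have [[pT qT] pq pE qE] := (bsat_splits_form x _ _ _ c d).1 sat.
exists (strdecode a), (fun i => if i then strdecode q else strdecode p).
by split=> //=; [rewrite !strdecodeK | case | case].
Qed.

(** * The tree of a formula *)

Lemma Ext_in_tree s T : Ext s T -> in_tree T s.
Proof. by case/(_ 0)=> t; rewrite tuple0 cats0. Qed.

Lemma gamma_Perfect_binP a T :
  (forall b, gamma Perfect_bin a b T) <-> Ext (strdecode a) T.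
Proof.
split=> [H l|sE b].
  by have [s [-> _]] := H l; rewrite strcodeK.
by exists (strdecode a); rewrite strdecodeK; split=> //; exact: Ext_in_tree.
Qed.

Definition splits (s : seq bool) (t : bool -> seq bool) (T : baire) : Prop :=
  [/\ forall i, prefix s (t i), incomparable (t false) (t true)
    & forall i, Ext (t i) T].

(** The strings might depend on [d], but injectivity of the codings lets [a] and [c] determine them;
    those obtained for [d = 0] serve throughout. *)
Lemma theta_Perfect_binP a c T :
  (forall d, theta Perfect_bin a c d T) <->
  exists2 t, c = cpair (strcode (t false)) (strcode (t true)) & splits (strdecode a) t T.
Proof.
split=> [H|[t -> [st inc tE]] d].
  have [s [t [as_ ct sT inc _]]] := H 0; exists t => //.
  rewrite as_ strcodeK; split=> // [i|i l]; first by case: (sT i).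
  have [s' [t' [_ ct' _ _ /(_ i)]]] := H l.
  have [/strcode_inj e0 /strcode_inj e1] := cpair_inj (etrans (esym ct) ct').
  by case: i; rewrite ?e0 ?e1.
exists (strdecode a), t; rewrite strdecodeK.
by split=> // [i|i]; [split; [exact: Ext_in_tree|] | exact: tE].
Qed.

Definition after_true (s : seq bool) := drop (index true s).+1 s.

Definition node a (r : seq bool) := nseq a false ++ [:: true, false & r].

Lemma after_true_notin s : true \notin s -> after_true s = [::].
Proof. by move=> sN; rewrite /after_true memNindex // drop_oversize. Qed.

Lemma after_true_cat s u :
  after_true (s ++ u) = if true \in s then after_true s ++ u else after_true u.
Proof.
rewrite /after_true index_cat; case: ifP => [sT|sN].
  rewrite drop_cat; case: ltnP => // le; rewrite [drop _ s]drop_oversize //.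
  have /eqP -> : (index true s).+1 - size s == 0 by rewrite subn_eq0 index_mem.
  by rewrite drop0.
by rewrite drop_cat ltnNge -addnS leq_addr /= addKn.
Qed.

Lemma index_true_node a r : index true (node a r) = a.
Proof. by elim: a => //= a ->. Qed.

Lemma after_true_node a r : after_true (node a r) = false :: r.
Proof. by rewrite /after_true index_true_node; elim: a => //=; rewrite drop0. Qed.

Lemma node_cat a r u : node a r ++ u = node a (r ++ u).
Proof. by rewrite /node -catA. Qed.

(** With the default [true], the hypothesis excludes an empty remainder: a first [true] exists in
    [s] and is followed by [false]. *)
Lemma nodeP s : ~~ head true (after_true s) ->
  s = node (index true s) (behead (after_true s)).
Proof.
elim: s => //= -[] s IH; rewrite /after_true /= ?drop0.
  by case: s {IH} => //= -[].
by move=> /IH {1}->.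
Qed.

(** The default of [head] also admits 0^n and 0^n 1. If [r] has no [true], then [after_true r] is
    empty and the condition on [h] is vacuous. *)
Definition ctree (g : nat -> nat -> bool) (h : nat -> nat -> nat -> bool) s : bool :=
  let a := index true s in let r := behead (after_true s) in
  head true (after_true s) ||
  (all (g a) (iota 0 (size r)) &&
   all (h a (csnd (index true r))) (iota 0 (size (after_true r)))).

Definition ctreeb g h : baire := fun n => ctree g h (strdecode n).

Lemma in_ctreeb g h s : in_tree (ctreeb g h) s <-> ctree g h s.
Proof. by rewrite /in_tree /ctreeb strcodeK; case: ctree. Qed.

Lemma ctree_node g h a r : ctree g h (node a r) =
  all (g a) (iota 0 (size r)) &&
  all (h a (csnd (index true r))) (iota 0 (size (after_true r))).
Proof. by rewrite /ctree after_true_node index_true_node. Qed.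

Lemma all_iotaP (p : pred nat) n : reflect (forall k, k < n -> p k) (all p (iota 0 n)).
Proof.
apply: (iffP allP) => H k; first by move=> kn; apply: H; rewrite mem_iota.
by rewrite mem_iota; apply: H.
Qed.

(** Lengthening [r] only enlarges the ranges that are checked: a first [true] in [r] keeps its
    position, and without one there is no condition on [h]. *)
Lemma ctree_catl g h s u : ctree g h (s ++ u) -> ctree g h s.
Proof.
have [s1|/nodeP ->] := boolP (head true (after_true s)); first by rewrite /ctree s1.
rewrite node_cat !ctree_node => /andP[/all_iotaP ga /all_iotaP ha].
apply/andP; split; apply/all_iotaP => k kr.
  by apply: ga; rewrite size_cat ltn_addr.
move: (behead _) ha kr => r; rewrite after_true_cat index_cat.
case: ifP => [rT ha kr|/negbT/after_true_notin -> //].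
by apply: ha; rewrite size_cat ltn_addr.
Qed.

Lemma is_tree_ctreeb g h : is_tree (ctreeb g h).
Proof.
split=> [n|s t /prefixP[u ->]]; first by rewrite /ctreeb; case: ctree.
by rewrite !in_ctreeb; exact: ctree_catl.
Qed.

(** Appending only ones leads from 0^n through 0^n 1 to 0^n 1 1, and never to a string 0^a 1 0 r. *)
Lemma Ext_outside g h s : head true (after_true s) -> Ext s (ctreeb g h).
Proof.
move=> s1 l; exists [tuple of nseq l true]; apply/in_ctreeb; apply/orP; left.
rewrite after_true_cat; case: ifP => _; first by case: after_true s1 => //=; case: l.
by case: l => [|[|l]].
Qed.

(** An extension by [b.+1] letters forces the check of [b]. Conversely, padding with zeros
    introduces no new [true] and hence no new requirement on [h]. *)
Lemma Ext_node g h a r : Ext (node a r) (ctreeb g h) <->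
  (forall b, g a b) /\ (true \in r -> forall d, h a (csnd (index true r)) d).
Proof.
split=> [rE|[ga ha] l].
  split=> [b|rT d].
    have [t /in_ctreeb] := rE b.+1; rewrite node_cat ctree_node => /andP[/all_iotaP ga _].
    by apply: ga; rewrite size_cat size_tuple addnS ltnS leq_addl.
  have [t /in_ctreeb] := rE d.+1; rewrite node_cat ctree_node => /andP[_ /all_iotaP].
  rewrite after_true_cat index_cat rT => ha.
  by apply: ha; rewrite size_cat size_tuple addnS ltnS leq_addl.
exists [tuple of nseq l false]; apply/in_ctreeb; rewrite node_cat ctree_node.
apply/andP; split; apply/all_iotaP => k kl //; move: kl.
rewrite after_true_cat index_cat; case: ifP => [rT _|_]; first exact: ha.
by rewrite after_true_notin // mem_nseq andbF.
Qed.

(* Excludes exactly the nodes 0^a 1 0 0^n. *)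
Definition free_node s := head true (after_true s) || (true \in behead (after_true s)).

(** Two ones are needed for 0^n: the first ends the zeros, the second leaves the nodes 0^a 1 0 r for
    good. If [s] is such a node, its [r] already contains a [true], and extendibility passes to all
    its extensions. *)
Lemma Ext_free_node g h s u :
  free_node s -> Ext s (ctreeb g h) -> Ext (s ++ [:: true; true] ++ u) (ctreeb g h).
Proof.
have [s1 _ _|/nodeP -> ] := boolP (head true (after_true s)).
  apply: Ext_outside; rewrite after_true_cat; case: ifP => // _.
  by case: after_true s1.
rewrite /free_node after_true_node node_cat => /= rT /Ext_node[ga ha].
by apply/Ext_node; rewrite mem_cat index_cat rT; split=> // _; exact: ha.
Qed.

(** The padding puts the first [true] at position [cpair (size r) c], which encodes [c] and is not
    below [size r]. *)
Lemma Ext_stem (g : nat -> nat -> bool) (h : nat -> nat -> nat -> bool) a c r u :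
  true \notin r -> (forall b, g a b) -> (forall d, h a c d) ->
  Ext (node a r ++ (nseq (cpair (size r) c - size r) false ++ [:: true]) ++ u)
    (ctreeb g h).
Proof.
move=> rN ga hc; rewrite node_cat; apply/Ext_node; split=> // _.
rewrite -catA index_cat (negbTE rN) index_cat mem_nseq andbF size_nseq /= addn0.
by rewrite subnKC ?csnd_cpair // (leq_trans (leq_addr _ _) (leq_cpair _ c)).
Qed.

Lemma splits_cat g h s u :
  (forall i, Ext (s ++ u ++ [:: i]) (ctreeb g h)) ->
  splits s (fun i => s ++ u ++ [:: i]) (ctreeb g h).
Proof.
move=> sE; split=> // [i|]; first exact: prefix_prefix.
by rewrite /incomparable !catA; elim: (s ++ u) => //= b r; rewrite eqxx.
Qed.

Definition chosen (t : bool -> seq bool) : nat :=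
  let r i := behead (after_true (t i)) in
  csnd (index true (if true \in r false then r false else r true)).

(** Without a [true] in either remainder both strings would be of the form 0^a 1 0 0^n, hence
    comparable. So the string that [chosen] reads has a [true], and its extendibility gives the
    claim. *)
Lemma splits_node g h a t : splits (node a [::]) t (ctreeb g h) ->
  forall d, h a (chosen t) d.
Proof.
case=> st inc tE.
have tF i : exists r, t i = node a r.
  by have /prefixP[r ->] := st i; exists r; rewrite node_cat.
have [r0 t0] := tF false; have [r1 t1] := tF true; move: inc (tE false) (tE true).
rewrite /chosen t0 t1 !after_true_node /= => inc /Ext_node[_ h0] /Ext_node[_ h1].
case: ifPn => [/h0 // | r0N]; apply: h1; apply: contraT => r1N; move: inc.
have rE r : true \notin r -> r = nseq (size r) false.
  by move=> rN; apply/all_pred1P/allP => -[] // /(negP rN).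
rewrite (rE _ r0N) (rE _ r1N) /incomparable.
wlog le : r0 r1 {t0 t1 h0 r0N r1N} / size r0 <= size r1.
  by move=> W; case: (leqP (size r0) (size r1)) => [/W //|/ltnW/W]; rewrite andbC.
rewrite -(subnKC le) nseqD -node_cat prefix_prefix //.
Qed.

(** * The reduction *)

Lemma primrecs_after_true N f :
  primrecs N f -> primrecs N (fun o v => after_true (f o v)).
Proof.
by move=> nf; apply: primrecs_drop => //; exact/primrec_succ/primrec_index_true.
Qed.

Lemma primrecs_node0 N a : primrec N a -> primrecs N (fun o v => node (a o v) [::]).
Proof.
by move=> na; apply: primrecs_cat; [exact: primrecs_nseq0 | exact: primrecs_const].
Qed.

Lemma primrecb_ctree (g : seq baire -> nat -> nat -> bool)
    (h : seq baire -> nat -> nat -> nat -> bool) N f :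
  primrecb 2 (fun o v => g o (nth 0 v 0) (nth 0 v 1)) ->
  primrecb 3 (fun o v => h o (nth 0 v 0) (nth 0 v 1) (nth 0 v 2)) ->
  primrecs N f -> primrecb N (fun o v => ctree (g o) (h o) (f o v)).
Proof.
move=> ng nh nf.
have na := primrec_index_true nf; have nr := primrecs_after_true nf.
have nb := primrecs_behead nr.
have nc := primrec_csnd (primrec_index_true nb).
apply: primrecb_or; first exact: primrecb_head.
apply: primrecb_and.
  apply: (primrecb_all (p := fun o v => g o (index true (f o v)))).
    exact: primrec_size.
  exact: primrec_comp2 (primrec_weaken na) (primrec_nth _ 0) ng.
apply: (primrecb_all (p := fun o v => h o (index true (f o v))
  (csnd (index true (behead (after_true (f o v))))))).
  exact/primrec_size/primrecs_after_true.
exact: primrec_comp3 (primrec_weaken na) (primrec_weaken nc) (primrec_nth _ 0) nh.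
Qed.

(** * Translation of witnesses *)

Definition split_code s u :=
  cpair (strcode (s ++ u ++ [:: false])) (strcode (s ++ u ++ [:: true])).

Definition stem_split s c :=
  let n := size (behead (after_true s)) in
  split_code s (nseq (cpair n c - n) false ++ [:: true]).

(** Stage [m] treats one string together with one entry of [alpha]. Free nodes are split without
    consulting [alpha]; any other node needs an entry whose first component is its index, and 0 is
    emitted when the entry does not fit. *)
Definition perfect_witness (alpha : baire) : baire := fun m =>
  let s := strdecode (csnd m) in
  let y := alpha (cfst m) in
  if free_node s then (cpair (strcode s) (split_code s [:: true; true])).+1
  else if y == (cpair (index true s) (csnd y.-1)).+1
  then (cpair (strcode s) (stem_split s (csnd y.-1))).+1 else 0.

Definition chosen_code w := chosen (fun i => strdecode (if i then csnd w else cfst w)).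

Definition root a := strcode (node a [::]).

(** The equality test discards the empty entry 0 and all entries of [beta] about strings other than
    roots. *)
Definition formula_witness (beta : baire) : baire := fun n =>
  let y := beta n in
  let a := index true (strdecode (cfst y.-1)) in
  let w := csnd y.-1 in
  if y == (cpair (root a) w).+1 then (cpair a (chosen_code w)).+1 else 0.

Lemma graph_perfect_witness alpha s w : graph (perfect_witness alpha) (strcode s) w <->
  if free_node s then w = split_code s [:: true; true]
  else exists2 c, graph alpha (index true s) c & w = stem_split s c.
Proof.
split=> [[m]|].
  rewrite /perfect_witness; set s' := strdecode _.
  case: ifP => [s'1 [/cpair_inj[/strcode_inj es <-]]|s'0]; first by rewrite -es s'1.
  case: eqP => // ay [/cpair_inj[/strcode_inj es <-]]; rewrite -es s'0.
  by exists (csnd (alpha (cfst m)).-1) => //; exists (cfst m).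
case: ifP => [s1 ->|s0 [c [k kc] ->]]; rewrite /graph /perfect_witness.
  (* The component 0 is arbitrary: any entry of [alpha] would do at a free node. *)
  by exists (cpair 0 (strcode s)); rewrite csnd_cpair strcodeK s1.
exists (cpair k (strcode s)).
by rewrite csnd_cpair cfst_cpair strcodeK s0 kc /= csnd_cpair eqxx.
Qed.

Lemma graph_formula_witness beta a c : graph (formula_witness beta) a c <->
  exists2 w, graph beta (root a) w & c = chosen_code w.
Proof.
rewrite /graph /formula_witness; split=> [[n]|[w [n nw] ->]].
  case: eqP => // bn [/cpair_inj[<- <-]].
  by exists (csnd (beta n).-1) => //; exists n.
exists n; rewrite nw /= cfst_cpair csnd_cpair /root strcodeK index_true_node.
by rewrite eqxx.
Qed.

Lemma primrecs_split_code N s u : primrecs N s -> primrecs N u ->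
  primrec N (fun o v => split_code (s o v) (u o v)).
Proof.
move=> ns nu; apply: primrec_cpair; apply: primrecs_cat => //;
  by apply: primrecs_cat => //; exact: primrecs_const.
Qed.

Lemma primrec_stem_split N s c : primrecs N s -> primrec N c ->
  primrec N (fun o v => stem_split (s o v) (c o v)).
Proof.
move=> ns nc; have nr := primrec_size (primrecs_behead (primrecs_after_true ns)).
apply: primrecs_split_code => //; apply: primrecs_cat; last exact: primrecs_const.
by apply: primrecs_nseq0; apply: primrec_sub => //; exact: primrec_cpair.
Qed.

Lemma primrec_perfect_witness :
  primrec 1 (fun o v => perfect_witness (nth (fun=> 0) o 0) (nth 0 v 0)).
Proof.
have ns : primrecs 1 (fun o v => strdecode (csnd (nth 0 v 0))).
  exact/primrecs_decode/primrec_csnd/primrec_nth.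
have ny : primrec 1 (fun o v => nth (fun=> 0) o 0 (cfst (nth 0 v 0))).
  exact/primrec_oracle/primrec_cfst/primrec_nth.
have nc := primrec_csnd (primrec_pred ny).
apply: primrec_if.
- apply: primrecb_or; first exact/primrecb_head/primrecs_after_true.
  exact/primrecb_mem_true/primrecs_behead/primrecs_after_true.
- apply/primrec_succ/primrec_cpair => //.
  by apply: primrecs_split_code => //; exact: primrecs_const.
- apply: primrec_if; last exact: primrec_const.
    apply: primrecb_eq => //; apply/primrec_succ/primrec_cpair => //.
    exact: primrec_index_true.
  by apply/primrec_succ/primrec_cpair => //; exact: primrec_stem_split.
Qed.

Lemma primrec_chosen_code N w : primrec N w -> primrec N (fun o v => chosen_code (w o v)).
Proof.
move=> nw; apply/primrec_csnd/primrec_index_true.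
have n0 : primrecs N (fun o v => behead (after_true (strdecode (cfst (w o v))))).
  exact/primrecs_behead/primrecs_after_true/primrecs_decode/primrec_cfst.
have n1 : primrecs N (fun o v => behead (after_true (strdecode (csnd (w o v))))).
  exact/primrecs_behead/primrecs_after_true/primrecs_decode/primrec_csnd.
apply: primrec_ext (primrec_if (primrecb_mem_true n0) n0 n1) => o v.
by case: ifP.
Qed.

Lemma primrec_formula_witness :
  primrec 1 (fun o v => formula_witness (nth (fun=> 0) o 0) (nth 0 v 0)).
Proof.
have ny : primrec 1 (fun o v => nth (fun=> 0) o 0 (nth 0 v 0)).
  exact/primrec_oracle/primrec_nth.
have na : primrec 1 (fun o v =>
    index true (strdecode (cfst (nth (fun=> 0) o 0 (nth 0 v 0)).-1))).
  exact/primrec_index_true/primrecs_decode/primrec_cfst/primrec_pred.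
have nw := primrec_csnd (primrec_pred ny).
apply: primrec_if; last exact: primrec_const.
  apply: primrecb_eq => //; apply/primrec_succ/primrec_cpair => //.
  exact: primrecs_node0.
by apply/primrec_succ/primrec_cpair => //; exact: primrec_chosen_code.
Qed.

Lemma primrec_computes f : primrec 1 (fun o v => f o (nth 0 v 0)) ->
  exists c, forall o, computes c o (f o).
Proof. by case=> c cf; exists c => o n; exact: cf. Qed.

(** * Correctness of the reduction at a fixed parameter *)

Section Reduction.
Variables (phi : aeform) (x : baire).
Variables (g : nat -> nat -> bool) (h : nat -> nat -> nat -> bool).
Hypothesis gP : forall a b, gamma phi a b x <-> g a b.
Hypothesis hP : forall a c d, theta phi a c d x <-> h a c d.
Let T := ctreeb g h.

Lemma gamma_root a : (forall b, gamma phi a b x) ->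
  forall b, gamma Perfect_bin (root a) b T.
Proof.
move=> ga; apply/gamma_Perfect_binP; rewrite strcodeK.
by apply/Ext_node; split=> // b; exact/gP.
Qed.

Lemma theta_chosen a w : (forall d, theta Perfect_bin (root a) w d T) ->
  forall d, theta phi a (chosen_code w) d x.
Proof.
move/theta_Perfect_binP=> [t ->]; rewrite strcodeK => /splits_node ht d; apply/hP.
suff -> : chosen_code (cpair (strcode (t false)) (strcode (t true))) = chosen t by [].
by rewrite /chosen_code /chosen cfst_cpair csnd_cpair !strcodeK.
Qed.

Lemma theta_free s : free_node s -> (forall b, gamma Perfect_bin (strcode s) b T) ->
  forall d, theta Perfect_bin (strcode s) (split_code s [:: true; true]) d T.
Proof.
move=> s1 /gamma_Perfect_binP; rewrite strcodeK => sE; apply/theta_Perfect_binP.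
eexists; last by rewrite strcodeK; apply: splits_cat => i; exact: Ext_free_node sE.
by [].
Qed.

Lemma gamma_stem s : ~~ free_node s -> (forall b, gamma Perfect_bin (strcode s) b T) ->
  forall b, gamma phi (index true s) b x.
Proof.
rewrite negb_or => /andP[/nodeP sN _] /gamma_Perfect_binP; rewrite strcodeK.
by rewrite {1}sN => /Ext_node[ga _] b; apply/gP.
Qed.

Lemma theta_stem s c : ~~ free_node s -> (forall b, gamma phi (index true s) b x) ->
  (forall d, theta phi (index true s) c d x) ->
  forall d, theta Perfect_bin (strcode s) (stem_split s c) d T.
Proof.
rewrite negb_or => /andP[/nodeP sE rN] ga hc; apply/theta_Perfect_binP.
eexists; last first.
  rewrite strcodeK; apply: splits_cat => i.
  rewrite {1}sE; apply: Ext_stem => // [b|d]; [exact/gP | exact/hP].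
by [].
Qed.

(** Extendible free nodes always split; an extendible stem 0^a 1 0 0^n has an index satisfying the
    premise and splits along its [c]. Conversely, a split of [root a] reveals a suitable [c]. *)
Lemma holds_ctreeb : holds phi x <-> holds Perfect_bin T.
Proof.
split=> H a ga.
  rewrite -(strdecodeK a) in ga *; set s := strdecode a in ga *.
  have [s1|s0] := boolP (free_node s); first by eexists; exact: theta_free.
  have gs := gamma_stem s0 ga; have [c hc] := H _ gs.
  by eexists; exact: theta_stem hc.
have [w hw] := H _ (gamma_root ga); exists (chosen_code w); exact: theta_chosen.
Qed.

(** By contraposition of [theta_chosen]; a refuting [d] is then extracted classically. *)
Lemma counterexample_root a :
  (forall b, gamma phi a b x) /\ (forall c, exists d, ~ theta phi a c d x) ->
  (forall b, gamma Perfect_bin (root a) b T) /\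
  (forall c, exists d, ~ theta Perfect_bin (root a) c d T).
Proof.
case=> ga nc; split=> [|w]; first exact: gamma_root.
apply: not_all_ex_not => /theta_chosen hw.
by have [d] := nc (chosen_code w).
Qed.

(** A counterexample cannot be a free node, since those split. It is thus a stem, and a [c] that
    suits its index would split it. *)
Lemma counterexample_index a :
  (forall b, gamma Perfect_bin a b T) /\
  (forall c, exists d, ~ theta Perfect_bin a c d T) ->
  let a' := index true (strdecode a) in
  (forall b, gamma phi a' b x) /\ (forall c, exists d, ~ theta phi a' c d x).
Proof.
rewrite -{1 2}(strdecodeK a); set s := strdecode a; case=> ga nc.
have s0 : ~~ free_node s.
  apply/negP => s1; have [d] := nc (split_code s [:: true; true]); apply.
  exact: theta_free.
have gs := gamma_stem s0 ga; split=> // c; apply: not_all_ex_not => hc.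
have [d] := nc (stem_split s c); apply; exact: theta_stem.
Qed.

(** Single-valuedness is inherited at stems: [alpha] provides at most one [c] for the index, and the
    split depends only on the stem and [c]. *)
Lemma witness_perfect_witness alpha :
  witness phi x alpha -> witness Perfect_bin T (perfect_witness alpha).
Proof.
case=> fun_alpha wit; split=> [a w w'|a ga].
  rewrite -(strdecodeK a) !graph_perfect_witness; case: ifP => [_ -> -> //|_].
  by case=> c ac -> [c' ac' ->]; rewrite (fun_alpha _ _ _ ac ac').
rewrite -(strdecodeK a) in ga *; set s := strdecode a in ga *.
have [s1|s0] := boolP (free_node s).
  by eexists; split; last exact: theta_free; apply/graph_perfect_witness; rewrite s1.
have gs := gamma_stem s0 ga; have [c [ac hc]] := wit _ gs.
eexists; split; last exact: theta_stem hc.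
by apply/graph_perfect_witness; rewrite (negbTE s0); exists c.
Qed.

Lemma witness_formula_witness beta :
  witness Perfect_bin T beta -> witness phi x (formula_witness beta).
Proof.
case=> fun_beta wit; split=> [a c c'|a ga].
  rewrite !graph_formula_witness => -[w bw ->] [w' bw' ->].
  by rewrite (fun_beta _ _ _ bw bw').
have [w [bw hw]] := wit _ (gamma_root ga).
exists (chosen_code w); split; last exact: theta_chosen.
by apply/graph_formula_witness; exists w.
Qed.
End Reduction.

Lemma le_dm_Perfect_bin phi : is_AE_formula phi -> le_dm phi Perfect_bin.
Proof.
move=> [G [H [GP HP]]].
pose g x a b := bsat x [:: a; b] G; pose h x a c d := bsat x [:: a; c; d] H.
pose T x := ctreeb (g x) (h x).
have [eta etaP] : exists eta, forall o, computes eta o (T (nth (fun=> 0) o 0)).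
  apply: (primrec_computes (f := fun o => T (nth (fun=> 0) o 0))).
  have nG : primrecb 2 (fun o v => g (nth (fun=> 0) o 0) (nth 0 v 0) (nth 0 v 1)).
    by have [c cG] := primrecb_bsat 2 G; exists c => o [|a [|b []]] // vN; exact: cG.
  have nH : primrecb 3 (fun o v =>
      h (nth (fun=> 0) o 0) (nth 0 v 0) (nth 0 v 1) (nth 0 v 2)).
    by have [c cH] := primrecb_bsat 3 H; exists c => o [|a [|b [|d []]]] // vN; exact: cH.
  exact: primrecb_ctree nG nH (primrecs_decode (primrec_nth _ _)).
have gP x a b : gamma phi a b x <-> g x a b by exact: GP.
have hP x a c d : theta phi a c d x <-> h x a c d by exact: HP.
have inst x : is_instance phi x -> is_instance Perfect_bin (T x).
  case=> cx _; split; last exact: is_tree_ctreeb.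
  exact: computable_computes cx (etaP [:: x]).
exists eta; split.
  have [rm rmP] := primrec_computes (f := fun o => perfect_witness (nth (fun=> 0) o 0))
    primrec_perfect_witness.
  have [rp rpP] := primrec_computes (f := fun o => formula_witness (nth (fun=> 0) o 0))
    primrec_formula_witness.
  exists rm, rp => x xI; exists (T x); split; first exact: (etaP [:: x]).
  - exact: inst.
  - exact: holds_ctreeb (gP x) (hP x).
  - move=> alpha wa; exists (perfect_witness alpha).
    split; first exact: (rmP [:: alpha; x]).
    exact: witness_perfect_witness (gP x) (hP x) _ wa.
  - move=> beta wb; exists (formula_witness beta).
    split; first exact: (rpP [:: beta; x]).
    exact: witness_formula_witness (gP x) (hP x) _ wb.
(* Dual witnesses are constant sequences, so both translations act entry by entry. *)
have [rm rmP] := primrec_computes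
  (f := fun o n => root (nth (fun=> 0) o 0 n))
  (primrecs_node0 (primrec_oracle 0 (primrec_nth _ _))).
have [rp rpP] := primrec_computes
  (f := fun o n => index true (strdecode (nth (fun=> 0) o 0 n)))
  (primrec_index_true (primrecs_decode (primrec_oracle 0 (primrec_nth _ _)))).
exists rm, rp => x xI; exists (T x); split; first exact: (etaP [:: x]).
- exact: inst.
- split=> -[a].
    by move/(counterexample_root (gP x) (hP x)); exists (root a).
  move/(counterexample_index (gP x) (hP x)).
  by exists (index true (strdecode a)).
- move=> alpha [a [ea ga nc]]; eexists; split; first exact: (rmP [:: alpha; x]).
  have [gr nr] := counterexample_root (gP x) (hP x) (conj ga nc).
  by exists (root a); split=> // n; rewrite /= ea.
- move=> beta [a [ea ga nc]]; eexists; split; first exact: (rpP [:: beta; x]).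
  have [gr nr] := counterexample_index (gP x) (hP x) (conj ga nc).
  by exists (index true (strdecode a)); split=> // n; rewrite /= ea.
Qed.

Theorem theorem3p30 : dicomplete Perfect_bin.
Proof.
(* [Perfect_bin] is itself strictly dicomplete, and its reduction to itself provides both directions
   of the equivalence. *)
have PP := le_dm_Perfect_bin Perfect_bin_is_AE_formula.
exists Perfect_bin; split=> //; split; first exact: Perfect_bin_is_AE_formula.
exact: le_dm_Perfect_bin.
Qed.
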